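(* Let $\mathcal{F}$ be a class of simple graphs and consider the assertions: (1) $\mathcal{F}$ is closed under edge contraction and edge deletion; (2) $\equiv_{\mathcal{F}}$ is preserved under taking complements, i.e.\ for all simple graphs $G$ and $H$ it holds that $G\equiv_{\mathcal{F}}H$ if and only if $\overline{G}\equiv_{\mathcal{F}}\overline{H}$; (3) $\mathrm{cl}(\mathcal{F})$ is minor-closed. Then (1) implies (2), and (2) and (3) are equivalent.
   Context: All graphs are finite, undirected, without multiple edges; simple means without loops. $\hom(F,G)$ is the number of homomorphisms $F\to G$; $G\equiv_{\mathcal{F}}H$ means $\hom(F,G)=\hom(F,H)$ for all $F\in\mathcal{F}$; $\mathrm{cl}(\mathcal{F})$ is the class of all simple graphs $K$ such that for all simple $G,H$, $G\equiv_{\mathcal{F}}H$ implies $\hom(K,G)=\hom(K,H)$. $\overline{G}$ is the complement of a simple graph $G$ (same vertex set, edges $\binom{V(G)}{2}\setminus E(G)$). For a partition $\mathcal{P}$ of $V(F)$, $F/\mathcal{P}$ is the simple graph with vertex set $\mathcal{P}$ and an edge $PQ$ ($P\neq Q$) iff some $p\in P,q\in Q$ are adjacent in $F$. $F'$ is obtained from $F$ by contracting edges if $F'\cong F/\mathcal{P}$ for a partition $\mathcal{P}$ with all $F[P]$ connected. Edge deletion produces a graph with the same vertex set and a subset of the edges. A minor of $F$ is a subgraph of a graph obtained from $F$ by contracting edges. *)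

(* Defs.v *)
From mathcomp Require Import all_boot.
Set Implicit Arguments. Unset Strict Implicit. Unset Printing Implicit Defensive.

Record sgraph := SGraph {
  sg_n : nat;
  sg_adj : rel 'I_sg_n;
  sg_sym : symmetric sg_adj;
  sg_irr : irreflexive sg_adj }.

Definition hom (F G : sgraph) : nat :=
  #|[pred f : {ffun 'I_(sg_n F) -> 'I_(sg_n G)} |
     [forall u, forall v, sg_adj u v ==> sg_adj (f u) (f v)]]|.

Definition hom_equiv (C : sgraph -> Prop) (G H : sgraph) : Prop :=
  forall K, C K -> hom K G = hom K H.

Definition cl (C : sgraph -> Prop) (K : sgraph) : Prop :=
  forall G H, hom_equiv C G H -> hom K G = hom K H.

Definition compl_adj (G : sgraph) : rel 'I_(sg_n G) :=
  fun x y => (x != y) && ~~ sg_adj x y.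
Lemma compl_sym (G : sgraph) : symmetric (@compl_adj G).
Proof. by move=> x y; rewrite /compl_adj eq_sym sg_sym. Qed.
Lemma compl_irr (G : sgraph) : irreflexive (@compl_adj G).
Proof. by move=> x; rewrite /compl_adj eqxx. Qed.
Definition compl (G : sgraph) : sgraph := SGraph (@compl_sym G) (@compl_irr G).

Definition iso (G H : sgraph) : Prop :=
  exists f : 'I_(sg_n G) -> 'I_(sg_n H),
    bijective f /\ forall u v, sg_adj (f u) (f v) = sg_adj u v.

(* Quotient F/P: the partition P is given by a surjective labelling
   p : V(F) -> 'I_k, whose fibres are the blocks. *)
Definition quot_adj (F : sgraph) k (p : 'I_(sg_n F) -> 'I_k) : rel 'I_k :=
  fun a b => (a != b) &&
    [exists u, exists v, [&& sg_adj u v, p u == a & p v == b]].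
Lemma quot_sym (F : sgraph) k (p : 'I_(sg_n F) -> 'I_k) : symmetric (@quot_adj F k p).
Proof.
move=> a b; rewrite /quot_adj eq_sym; congr (_ && _).
apply/existsP/existsP=> -[u /existsP [v /and3P [uv pu pv]]];
  by exists v; apply/existsP; exists u; rewrite sg_sym uv pu pv.
Qed.
Lemma quot_irr (F : sgraph) k (p : 'I_(sg_n F) -> 'I_k) : irreflexive (@quot_adj F k p).
Proof. by move=> a; rewrite /quot_adj eqxx. Qed.
Definition quot (F : sgraph) k (p : 'I_(sg_n F) -> 'I_k) : sgraph :=
  SGraph (@quot_sym F k p) (@quot_irr F k p).

(* every block F[P] is connected (blocks are nonempty by surjectivity) *)
Definition blocks_connected (F : sgraph) k (p : 'I_(sg_n F) -> 'I_k) : Prop :=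
  forall u v, p u = p v ->
    connect (fun x y => sg_adj x y && (p x == p y)) u v.

Definition contraction_of (F F' : sgraph) : Prop :=
  exists k (p : 'I_(sg_n F) -> 'I_k),
    (forall a, exists u, p u = a) /\ blocks_connected (F:=F) p /\ iso F' (@quot F k p).

(* edge deletion: same vertex set, a subset of the edges
   (every subset of edges is of this form for a suitable e) *)
Definition del_adj (G : sgraph) (e : rel 'I_(sg_n G)) : rel 'I_(sg_n G) :=
  fun x y => [&& sg_adj x y, e x y & e y x].
Lemma del_sym (G : sgraph) (e : rel 'I_(sg_n G)) : symmetric (@del_adj G e).
Proof. by move=> x y; rewrite /del_adj sg_sym; case: (e x y); case: (e y x); rewrite ?andbF. Qed.
Lemma del_irr (G : sgraph) (e : rel 'I_(sg_n G)) : irreflexive (@del_adj G e).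
Proof. by move=> x; rewrite /del_adj sg_irr. Qed.
Definition del_edges (G : sgraph) (e : rel 'I_(sg_n G)) : sgraph :=
  SGraph (@del_sym G e) (@del_irr G e).

Definition subgraph (H G : sgraph) : Prop :=
  exists f : 'I_(sg_n H) -> 'I_(sg_n G),
    injective f /\ forall u v, sg_adj u v -> sg_adj (f u) (f v).

Definition minor (H F : sgraph) : Prop :=
  exists F', contraction_of F F' /\ subgraph H F'.

Definition closed_contraction (C : sgraph -> Prop) : Prop :=
  forall F F', C F -> contraction_of F F' -> C F'.
Definition closed_deletion (C : sgraph -> Prop) : Prop :=
  forall G e, C G -> C (@del_edges G e).
Definition compl_preserved (C : sgraph -> Prop) : Prop :=
  forall G H, hom_equiv C G H <-> hom_equiv C (compl G) (compl H).
Definition minor_closed (C : sgraph -> Prop) : Prop :=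
  forall K K', C K -> minor K' K -> C K'.

(* Main.v *)
Require Import Defs.
From mathcomp Require Import all_boot all_order ssralg ssrnum ssrint.
Set Implicit Arguments. Unset Strict Implicit. Unset Printing Implicit Defensive.

(** Expanding [1 - [f u = f v] - adj (f u) (f v)] over the edges uv of K writes
    hom(K, compl G) as a signed sum of hom(F, G), where F runs over the graphs obtained
    from K by deleting some edges and contracting others; the sign is the parity of the
    number of edges that were not deleted. If the class is closed under both operations,
    this determines hom(K, compl G) from the numbers hom(F, G).

    Conversely, let K be in cl(C) and G, H equivalent. Then G x X and H x X are equivalent
    for every X, so replacing G by G x X and using that the functions hom(F, -) of pairwise
    non-isomorphic F are linearly independent, every F with nonzero total coefficient lies
    in cl(C). The coefficient of a pure deletion of K is nonzero because all its
    contributions keep the same number of edges. For a contraction F, one first deletes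
    edges from K as long as F remains a contraction; then all contributions to F use every
    edge. Finally, hom(F + j K_1, G) = hom(F, G) |G|^j removes isolated vertices. *)

(** * Homomorphism counts and isomorphism *)

Definition is_hom (F G : sgraph) (f : 'I_(sg_n F) -> 'I_(sg_n G)) : bool :=
  [forall u, forall v, sg_adj u v ==> sg_adj (f u) (f v)].

Lemma is_homP (F G : sgraph) (f : 'I_(sg_n F) -> 'I_(sg_n G)) :
  reflect (forall u v, sg_adj u v -> sg_adj (f u) (f v)) (is_hom f).
Proof.
apply: (iffP forallP) => [h u v uv | h u].
  by have /forallP/(_ v)/implyP := h u; apply.
by apply/forallP => v; apply/implyP/h.
Qed.

Lemma homE (F G : sgraph) :
  hom F G = #|[pred f : {ffun 'I_(sg_n F) -> 'I_(sg_n G)} | is_hom f]|.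
Proof. by []. Qed.

Lemma iso_refl (G : sgraph) : iso G G.
Proof. by exists id; split=> //; exists id. Qed.

Lemma iso_sym (G H : sgraph) : iso G H -> iso H G.
Proof.
move=> [f [[g fK gK] fE]]; exists g; split; first by exists f.
by move=> u v; rewrite -fE !gK.
Qed.

Lemma iso_trans (G H K : sgraph) : iso G H -> iso H K -> iso G K.
Proof.
move=> [f [bf fE]] [g [bg gE]]; exists (g \o f); split; first exact: bij_comp.
by move=> u v /=; rewrite gE fE.
Qed.

Lemma iso_of_n0 (G H : sgraph) : sg_n G = 0 -> sg_n H = 0 -> iso G H.
Proof.
case: G => n e es ei; case: H => m e' es' ei' /= En Em; subst.
exists id; split; first by exists id.
by case.
Qed.

Lemma hom_iso (F F' G G' : sgraph) : iso F F' -> iso G G' -> hom F G = hom F' G'.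
Proof.
move=> [f [[f' fK f'K] fE]] [g [[g' gK g'K] gE]]; rewrite !homE.
pose phi (h : {ffun 'I_(sg_n F) -> 'I_(sg_n G)}) : {ffun 'I_(sg_n F') -> 'I_(sg_n G')} :=
  [ffun u => g (h (f' u))].
have phi_inj : injective phi.
  move=> h1 h2 /ffunP E; apply/ffunP => u.
  by have := E (f u); rewrite !ffunE fK => /(can_inj gK).
rewrite -(card_image phi_inj); apply: eq_card => h; rewrite inE.
apply/imageP/is_homP => [[h0 /is_homP h0P ->] u v uv|hP].
  by rewrite !ffunE gE h0P // -fE !f'K.
exists [ffun u => g' (h (f u))].
  by apply/is_homP => u v uv; rewrite !ffunE -gE !g'K hP // fE.
by apply/ffunP => u; rewrite !ffunE f'K g'K.
Qed.

Lemma iso_compl_compl (G : sgraph) : iso (compl (compl G)) G.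
Proof.
exists id; split; first by exists id.
move=> u v /=; rewrite /compl_adj /= /compl_adj; case: eqP => [->|] /=.
  by rewrite sg_irr.
by rewrite negbK.
Qed.

(** * Products and induced subgraphs *)

Section GraphOfFinType.
Variables (T : finType) (e : rel T).
Hypotheses (e_sym : symmetric e) (e_irr : irreflexive e).

(** Vertices of an [sgraph] are ordinals, so a graph on pairs or on a subset is transported along
    [enum_val]. *)
Definition fin_adj : rel 'I_#|T| := fun x y => e (enum_val x) (enum_val y).
Lemma fin_sym : symmetric fin_adj. Proof. by move=> x y; exact: e_sym. Qed.
Lemma fin_irr : irreflexive fin_adj. Proof. by move=> x; exact: e_irr. Qed.
Definition fin_graph : sgraph := SGraph fin_sym fin_irr.

Lemma hom_fin_graph (F : sgraph) :
  hom F fin_graph =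
  #|[pred f : {ffun 'I_(sg_n F) -> T} |
     [forall u, forall v, sg_adj u v ==> e (f u) (f v)]]|.
Proof.
rewrite homE.
pose phi (h : {ffun 'I_(sg_n F) -> 'I_#|T|}) : {ffun 'I_(sg_n F) -> T} :=
  [ffun u => enum_val (h u)].
have phi_inj : injective phi.
  move=> h1 h2 /ffunP E; apply/ffunP => u.
  by have := E u; rewrite !ffunE => /enum_val_inj.
rewrite -(card_image phi_inj); apply: eq_card => h; rewrite inE.
apply/imageP/forallP => [[h0 /is_homP h0P ->] u|hP].
  by apply/forallP => v; apply/implyP => /h0P; rewrite !ffunE.
exists [ffun u => enum_rank (h u)].
  apply/is_homP => u v uv; rewrite !ffunE /= /fin_adj !enum_rankK.
  by have /forallP/(_ v)/implyP := hP u; apply.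
by apply/ffunP => u; rewrite !ffunE enum_rankK.
Qed.
End GraphOfFinType.

Section Product.
Variables G H : sgraph.
Let e : rel ('I_(sg_n G) * 'I_(sg_n H)) :=
  fun x y => sg_adj x.1 y.1 && sg_adj x.2 y.2.
Lemma prod_sym : symmetric e.
Proof. by move=> x y; rewrite /e sg_sym (sg_sym x.2). Qed.
Lemma prod_irr : irreflexive e. Proof. by move=> x; rewrite /e sg_irr. Qed.
Definition prod_graph : sgraph := fin_graph prod_sym prod_irr.

Lemma hom_prod (F : sgraph) : hom F prod_graph = hom F G * hom F H.
Proof.
rewrite hom_fin_graph !homE -cardX.
pose phi (h : {ffun 'I_(sg_n F) -> 'I_(sg_n G)} * {ffun 'I_(sg_n F) -> 'I_(sg_n H)}) :
  {ffun 'I_(sg_n F) -> 'I_(sg_n G) * 'I_(sg_n H)} := [ffun u => (h.1 u, h.2 u)].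
have phi_inj : injective phi.
  move=> [h1 h2] [k1 k2] /ffunP E.
  by congr pair; apply/ffunP => u; have := E u; rewrite !ffunE => -[].
rewrite -(card_image phi_inj); apply: eq_card => h; rewrite inE.
apply/forallP/imageP => [hP|[[h1 h2] /andP[/is_homP h1P /is_homP h2P] ->] u].
  have {}hP u v : sg_adj u v -> e (h u) (h v).
    by have /forallP/(_ v)/implyP := hP u; apply.
  exists ([ffun u => (h u).1], [ffun u => (h u).2]).
    apply/andP; split; apply/is_homP => u v /hP; rewrite !ffunE /=.
      by case/andP.
    by case/andP.
  by apply/ffunP => u; rewrite !ffunE /=; case: (h u).
apply/forallP => v; apply/implyP => uv; rewrite /e !ffunE /=.
by rewrite h1P ?h2P.
Qed.
End Product.

Section Induced.
Variables (G : sgraph) (S : {set 'I_(sg_n G)}).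
Let e : rel {x | x \in S} := fun x y => sg_adj (val x) (val y).
Lemma induced_sym : symmetric e. Proof. by move=> x y; exact: sg_sym. Qed.
Lemma induced_irr : irreflexive e. Proof. by move=> x; exact: sg_irr. Qed.
Definition induced : sgraph := fin_graph induced_sym induced_irr.

Lemma hom_induced (F : sgraph) :
  hom F induced =
  #|[pred f : {ffun 'I_(sg_n F) -> 'I_(sg_n G)} | is_hom f && (f @: setT \subset S)]|.
Proof.
rewrite hom_fin_graph.
pose phi (h : {ffun 'I_(sg_n F) -> {x | x \in S}}) : {ffun 'I_(sg_n F) -> 'I_(sg_n G)} :=
  [ffun u => val (h u)].
have phi_inj : injective phi.
  move=> h1 h2 /ffunP E; apply/ffunP => u; apply: val_inj.
  by have := E u; rewrite !ffunE.
rewrite -(card_image phi_inj); apply: eq_card => h; rewrite inE.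
apply/imageP/andP => [[h0 /forallP h0P ->]|[/is_homP hP /subsetP hS]].
  split.
    apply/is_homP => u v uv; rewrite !ffunE.
    by have /forallP/(_ v)/implyP := h0P u; apply.
  by apply/subsetP => x /imsetP[u _ ->]; rewrite ffunE; exact: valP.
have hS' u : h u \in S by apply: hS; rewrite imset_f.
exists [ffun u => exist (fun x => x \in S) (h u) (hS' u)].
  apply/forallP => u; apply/forallP => v; apply/implyP => /hP.
  by rewrite !ffunE.
by apply/ffunP => u; rewrite !ffunE.
Qed.
End Induced.

(** * Homomorphism counts determine a graph up to isomorphism *)

Definition hom_onto (F G : sgraph) (S : {set 'I_(sg_n G)}) : nat :=
  #|[pred f : {ffun 'I_(sg_n F) -> 'I_(sg_n G)} | is_hom f && (f @: setT == S)]|.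

Lemma hom_induced_sum (F G : sgraph) (S : {set 'I_(sg_n G)}) :
  hom F (induced S) = \sum_(T : {set 'I_(sg_n G)} | T \subset S) hom_onto F T.
Proof.
rewrite hom_induced -sum1_card.
rewrite (partition_big (fun f : {ffun _ -> _} => f @: setT)
          (fun T : {set 'I_(sg_n G)} => T \subset S)) /=; last by move=> f /andP[].
apply: eq_bigr => T TS; rewrite /hom_onto -sum1_card; apply: eq_bigl => f.
rewrite !inE -andbA; congr (_ && _).
by case: (f @: setT =P T) => [->|]; rewrite ?TS ?andbF.
Qed.

(** Inversion over the subset lattice: sorting homomorphisms by image, all terms for proper subsets
    of [S] agree by induction and cancel, leaving the term for [S]. *)
Lemma hom_onto_eq (F F' G : sgraph) :
  (forall S : {set 'I_(sg_n G)}, hom F (induced S) = hom F' (induced S)) ->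
  forall S : {set 'I_(sg_n G)}, hom_onto F S = hom_onto F' S.
Proof.
move=> E S; have [m] := ubnP #|S|; elim: m => // m IH in S *; rewrite ltnS => leS.
have := E S; rewrite !hom_induced_sum (bigD1 S) //= [RHS](bigD1 S) //=.
rewrite (eq_bigr (fun T => hom_onto F' T)) => [|T /andP[TS neTS]].
  by move/addIn.
apply: IH; apply: leq_trans leS; apply: proper_card.
by rewrite properEneq neTS.
Qed.

(* Ordered pairs: twice the number of edges. *)
Definition darts (G : sgraph) : {set 'I_(sg_n G) * 'I_(sg_n G)} :=
  [set e | sg_adj e.1 e.2].

Lemma pair_map_inj (A B : Type) (f : A -> B) :
  injective f -> injective (fun e : A * A => (f e.1, f e.2)).
Proof. by move=> fI [a b] [c d] /= [/fI -> /fI ->]. Qed.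

Lemma leq_darts (F G : sgraph) (f : 'I_(sg_n F) -> 'I_(sg_n G)) :
  injective f -> is_hom f -> #|darts F| <= #|darts G|.
Proof.
move=> /pair_map_inj fI /is_homP fP; rewrite -(card_imset _ fI).
by apply/subset_leq_card/subsetP => _ /imsetP[e + ->]; rewrite !inE => /fP.
Qed.

Lemma iso_darts (F G : sgraph) : iso F G -> #|darts F| = #|darts G|.
Proof.
have le A B : iso A B -> #|darts A| <= #|darts B|.
  move=> [f [/bij_inj fI fE]]; apply: (leq_darts fI).
  by apply/is_homP => u v; rewrite fE.
by move=> FG; apply/eqP; rewrite eqn_leq !le //; exact: iso_sym.
Qed.

Lemma hom_onto_setT_gt0 (F G : sgraph) :
  0 < hom_onto F [set: 'I_(sg_n G)] ->
  exists2 f : {ffun 'I_(sg_n F) -> 'I_(sg_n G)}, is_hom f & f @: setT = setT.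
Proof. by case/card_gt0P => f /andP[fh /eqP fT]; exists f. Qed.

Lemma hom_onto_self (F : sgraph) : 0 < hom_onto F [set: 'I_(sg_n F)].
Proof.
apply/card_gt0P; exists [ffun u => u]; apply/andP; split.
  by apply/is_homP => u v; rewrite !ffunE.
by apply/eqP/setP => u; rewrite in_setT; apply/imsetP; exists u; rewrite ?ffunE.
Qed.

Lemma onto_leq (F G : sgraph) (f : {ffun 'I_(sg_n F) -> 'I_(sg_n G)}) :
  f @: setT = setT -> sg_n G <= sg_n F.
Proof.
by move=> fT; rewrite -(card_ord (sg_n G)) -cardsT -fT -[leqRHS]card_ord -cardsT leq_imset_card.
Qed.

Lemma onto_inj (F G : sgraph) (f : {ffun 'I_(sg_n F) -> 'I_(sg_n G)}) :
  f @: setT = setT -> sg_n G = sg_n F -> injective f.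
Proof.
move=> fT E u v uv; have/imset_injP : #|f @: setT| == #|[set: 'I_(sg_n F)]|.
  by rewrite fT !cardsT !card_ord E.
by apply; rewrite ?in_setT.
Qed.

(** Surjections both ways force equal vertex numbers, so both maps are injective. They then inject
    darts both ways, the dart counts agree, and [f] also reflects adjacency. *)
Lemma onto_iso (F G : sgraph) (f : {ffun 'I_(sg_n F) -> 'I_(sg_n G)})
    (g : {ffun 'I_(sg_n G) -> 'I_(sg_n F)}) :
  is_hom f -> f @: setT = setT -> is_hom g -> g @: setT = setT -> iso F G.
Proof.
move=> fh fT gh gT.
have En : sg_n G = sg_n F.
  by apply/eqP; rewrite eqn_leq (onto_leq fT) (onto_leq gT).
have fI := onto_inj fT En; have gI := onto_inj gT (esym En).
exists f; split; first by apply: inj_card_bij => //; rewrite !card_ord En.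
have dE : [set (f e.1, f e.2) | e in darts F] = darts G.
  apply/eqP; rewrite eqEcard (card_imset _ (pair_map_inj fI)) (leq_darts gI gh) andbT.
  by apply/subsetP => _ /imsetP[e + ->]; rewrite !inE; apply/is_homP.
move=> u v; apply/idP/idP; last exact: (is_homP _ fh).
move=> uv; have : (f u, f v) \in darts G by rewrite inE.
by rewrite -dE => /imsetP[[a b] +] [/fI -> /fI ->]; rewrite inE.
Qed.

(** A boolean form of [iso], so that sums can be restricted to an isomorphism class. *)
Definition isob (F G : sgraph) : bool :=
  [exists f : {ffun 'I_(sg_n F) -> 'I_(sg_n G)},
    [&& sg_n F == sg_n G, injectiveb f &
        [forall u, forall v, sg_adj (f u) (f v) == sg_adj u v]]].

Lemma isoP (F G : sgraph) : reflect (iso F G) (isob F G).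
Proof.
apply: (iffP existsP) => [[f /and3P[/eqP En /injectiveP fI /forallP fE]]|[f [fB fE]]].
  exists f; split; first by apply: inj_card_bij => //; rewrite !card_ord En.
  by move=> u v; have /forallP/(_ v)/eqP := fE u.
exists [ffun u => f u]; apply/and3P; split.
- by have := bij_eq_card fB; rewrite !card_ord => ->.
- by apply/injectiveP => u v; rewrite !ffunE; apply: bij_inj.
- by apply/forallP => u; apply/forallP => v; rewrite !ffunE fE.
Qed.

(** Induced subgraphs of [F] and [F'] suffice as tests: if none separates, the identity maps, being
    surjective, yield surjective homomorphisms in both directions. *)
Lemma hom_separates (F F' : sgraph) :
  ~ iso F F' -> exists X, hom F X <> hom F' X.
Proof.
move=> nFF'.
have [/existsP[S /eqP neS]|/existsPn E] :=
  boolP [exists S : {set 'I_(sg_n F)}, hom F (induced S) != hom F' (induced S)].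
  by exists (induced S).
have [/existsP[S /eqP neS]|/existsPn E'] :=
  boolP [exists S : {set 'I_(sg_n F')}, hom F (induced S) != hom F' (induced S)].
  by exists (induced S).
have {}E := hom_onto_eq (fun S => eqP (negPn (E S))).
have {}E' := hom_onto_eq (fun S => eqP (negPn (E' S))).
have := hom_onto_self F; rewrite E => /hom_onto_setT_gt0[g gh gT].
have := hom_onto_self F'; rewrite -E' => /hom_onto_setT_gt0[f fh fT].
by case: nFF'; exact: onto_iso fh fT gh gT.
Qed.

(** * Linear independence of homomorphism counts *)

Import Order.TTheory GRing.Theory Num.Theory.
Local Open Scope ring_scope.

Lemma hom_self_neq0 (F : sgraph) : (hom F F)%:Z != 0.
Proof.
rewrite eqz_nat -lt0n; apply/card_gt0P; exists [ffun u => u].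
by apply/is_homP => u v; rewrite !ffunE.
Qed.

(* Products of test graphs multiply hom numbers, so the relation stays true
   after multiplication by [hom (F i) X - hom (F j) X]; such factors kill every
   graph that is not isomorphic to F0. *)
Lemma hom_independent (I : finType) (F : I -> sgraph) (w : I -> int) (F0 : sgraph) :
  (forall X, \sum_i w i * (hom (F i) X)%:Z = 0) ->
  \sum_(i | isob (F i) F0) w i = 0.
Proof.
move=> w0.
have [a [a0 aF wa]] : exists a : I -> int,
    [/\ forall i, i \in enum I -> ~~ isob (F i) F0 -> a i = 0,
        exists c, c != 0 /\ forall i, iso (F i) F0 -> a i = c
      & forall X, \sum_i w i * a i * (hom (F i) X)%:Z = 0].
  elim: (enum I) => [|j s [a [a0 [c [c0 ac]] wa]]].
    exists (fun=> 1); split=> //; first by exists 1; split; rewrite ?oner_eq0.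
    by move=> X; under eq_bigr do rewrite mulr1; exact: w0.
  have [jF0|njF0] := boolP (isob (F j) F0).
    exists a; split=> //; last by exists c.
    move=> i; rewrite inE => /predU1P[->|]; first by rewrite jF0.
    exact: a0.
  have [X neX] : exists X, hom (F j) X <> hom F0 X.
    by apply: hom_separates => /isoP; exact/negP.
  exists (fun i => a i * ((hom (F i) X)%:Z - (hom (F j) X)%:Z)); split=> //.
  - move=> i; rewrite inE => /predU1P[->|js ni]; first by rewrite subrr mulr0.
    by rewrite a0 ?mul0r.
  - exists (c * ((hom F0 X)%:Z - (hom (F j) X)%:Z)); split.
      by rewrite mulf_neq0 // subr_eq0 eqz_nat eq_sym; apply/eqP.
    by move=> i iF0; rewrite ac // (hom_iso iF0 (iso_refl X)).
  (* The relation at [X] x [Y] minus [hom (F j) X] times the relation at [Y] is the new relation. *)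
  - move=> Y; have := wa (prod_graph X Y); have := wa Y.
    move=> /(congr1 (fun z => z * (hom (F j) X)%:Z)); rewrite mul0r mulr_suml => wY wXY.
    transitivity (\sum_i w i * a i * (hom (F i) (prod_graph X Y))%:Z -
                  \sum_i w i * a i * (hom (F i) Y)%:Z * (hom (F j) X)%:Z).
      rewrite -sumrB; apply: eq_bigr => i _.
      by rewrite hom_prod PoszM mulrA mulrBr mulrBl mulrA; congr (_ - _); rewrite mulrAC.
    by rewrite wXY wY subrr.
(* Testing on [F0] leaves [c * hom F0 F0] times the wanted sum, and both factors are nonzero. *)
case: aF => c [c0 ac]; have := wa F0.
rewrite (bigID (fun i => isob (F i) F0)) /= [X in _ + X]big1 ?addr0 => [|i ni]; last first.
  by rewrite a0 ?mem_enum // mulr0 mul0r.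
under eq_bigr => i /isoP iF0 do rewrite ac // (hom_iso iF0 (iso_refl F0)) -mulrA.
move/eqP; rewrite -mulr_suml mulf_eq0 mulf_eq0 (negPf c0) (negPf (hom_self_neq0 F0)) !orbF.
by move/eqP.
Qed.

(** * Expansion of homomorphism counts into a complement *)

Lemma prod_bool_natr (R : comNzRingType) (I : finType) (b : I -> bool) :
  \prod_i (b i)%:R = [forall i, b i]%:R :> R.
Proof.
have [/forallP bT|/forallPn[i /negPf bi]] := boolP [forall i, b i].
  by apply: big1 => i _; rewrite bT.
by rewrite (bigD1 i) //= bi mul0r.
Qed.

Lemma card_sum_intr (I : finType) (P : pred I) : #|P|%:Z = \sum_i (P i)%:R.
Proof.
rewrite -sum1_card -[Posz _]natz natr_sum big_mkcond /=; apply: eq_bigr => i _.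
by rewrite unfold_in; case: (P i).
Qed.

Section Labelling.
Variable K : sgraph.
Local Notation V := 'I_(sg_n K).
(* An edge uv of K is stored as the pair (u, v) with u < v. It is deleted, contracted
   or kept according to whether its label is None, Some true or Some false. *)
Local Notation labelling := {ffun V * V -> option bool}.
Implicit Type t : labelling.

Definition edge (e : V * V) : bool := (e.1 < e.2)%N && sg_adj e.1 e.2.

Definition label t (x y : V) : option bool := if (x < y)%N then t (x, y) else t (y, x).

Lemma label_sym t x y : label t x y = label t y x.
Proof. by rewrite /label; case: ltngtP => // /val_inj ->. Qed.

Lemma label_edge t e : edge e -> label t e.1 e.2 = t e.
Proof. by case: e => x y /andP[/= xy _]; rewrite /label xy. Qed.

Definition support_graph t : sgraph := del_edges (fun x y : V => label t x y != None).

Lemma support_adj t (x y : V) :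
  @sg_adj (support_graph t) x y = sg_adj x y && (label t x y != None).
Proof. by rewrite /= /del_adj (label_sym t y x) andbb. Qed.

Definition contracted t : rel V := fun x y => sg_adj x y && (label t x y == Some true).

Lemma contracted_sym t : connect_sym (contracted t).
Proof.
by apply: sym_connect_sym => x y; rewrite /contracted sg_sym label_sym.
Qed.

(** A block is a component of the contracted edges, represented by its canonical root. *)
Definition block_type t := {x : V | roots (contracted t) x}.

Definition block t (x : V) : 'I_#|{: block_type t}| :=
  enum_rank (exist _ (root (contracted t) x) (roots_root (contracted_sym t) x) : block_type t).

Definition block_rep t (a : 'I_#|{: block_type t}|) : V := val (enum_val a).

Lemma block_repK t : cancel (@block_rep t) (block t).
Proof.
move=> a; apply: enum_val_inj; apply: val_inj; rewrite enum_rankK /=.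
exact: eqP (valP (enum_val a)).
Qed.

Lemma eq_block t x y : (block t x == block t y) = connect (contracted t) x y.
Proof.
rewrite (inj_eq enum_rank_inj) -(root_connect (contracted_sym t)).
by apply/eqP/eqP => [/(congr1 val)//|E]; apply: val_inj.
Qed.

Lemma contracted_block t x y : contracted t x y -> block t x = block t y.
Proof. by move=> xy; apply/eqP; rewrite eq_block connect1. Qed.

Definition label_minor t : sgraph := @quot (support_graph t) _ (block t).

Lemma label_minor_contraction t : contraction_of (support_graph t) (label_minor t).
Proof.
exists #|{: block_type t}|, (block t); split.
  by move=> a; exists (block_rep a); rewrite block_repK.
split; last exact: iso_refl.
move=> u v /eqP; rewrite eq_block; apply: connect_sub => x y xy; apply: connect1.
rewrite support_adj (contracted_block xy) eqxx andbT.
by case/andP: xy => -> /eqP ->.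
Qed.

(** Only edges carry a label other than [None], and no kept edge lies inside a block, where it would
    become a loop. Other labellings contribute nothing. *)
Definition admissible t : bool :=
  [forall e, (t e != None) ==>
     edge e && ((t e == Some false) ==> (block t e.1 != block t e.2))].

Lemma admissibleP t :
  reflect (forall e b, t e = Some b -> edge e /\ (b = false -> block t e.1 <> block t e.2))
          (admissible t).
Proof.
apply: (iffP forallP) => [tP e b te|tP e].
  have := tP e; rewrite te /= => /andP[-> h]; split=> // b0; apply/eqP.
  by apply: (implyP h); rewrite b0.
case te: (t e) => [b|] //=; have [-> h] := tP e b te.
by apply/implyP => /eqP[/h/eqP].
Qed.

Definition support t : {set V * V} := [set e | t e != None].

(** Ties the sign of a term to the dart count of its support graph: each labelled edge is stored in
    one orientation and gives two darts. *)
Lemma card_darts_support t : admissible t -> #|darts (support_graph t)| = #|support t|.*2.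
Proof.
move=> /admissibleP tP; rewrite -addnn.
have swap_inj : injective (fun e : V * V => (e.2, e.1)) by move=> [? ?] [? ?] [-> ->].
(* The darts are the union of the support and its reversal, which are disjoint because stored pairs
   are increasing. *)
rewrite -{2}(card_imset (mem (support t)) swap_inj) -cardsUI -[LHS]addn0.
congr (_ + _)%N; last first.
  apply/esym/eqP; rewrite cards_eq0 -subset0; apply/subsetP => e.
  rewrite !inE => /andP[+ /imsetP[f + E]]; rewrite inE.
  case te: (t e) => [b|//] _; case tf: (t f) => [c|//] _.
  have [/andP[lt1 _] _] := tP _ _ te; have [/andP[lt2 _] _] := tP _ _ tf.
  by move: lt1; rewrite E /= ltnNge ltnW.
congr #|pred_of_set _|; apply/setP => -[x y]; rewrite !inE support_adj /=.
have suppP u v : t (u, v) != None -> sg_adj u v /\ (u < v)%N.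
  by case tuv: (t (u, v)) => [b|//] _; have [/andP[/= -> ->]] := tP _ _ tuv.
apply/andP/orP => [[xy]|].
  rewrite /label; case: ifP => _ Hs; first by left.
  by right; apply/imsetP; exists (y, x); rewrite ?inE.
case=> [/[dup]/suppP[xy lt]|/imsetP[[a b]]].
  by rewrite /label lt xy.
by rewrite inE => /[dup]/suppP[ab lt] tab [-> ->]; rewrite label_sym /label lt sg_sym.
Qed.

Definition weight t : int := (-1) ^+ #|support t| * (admissible t)%:R.

Section Target.
Variable G : sgraph.
Implicit Type f : {ffun V -> 'I_(sg_n G)}.

Definition obeys f (e : V * V) (l : option bool) : bool :=
  if l is Some b then
    edge e && (if b then f e.1 == f e.2 else sg_adj (f e.1) (f e.2))
  else true.

Lemma is_hom_edges f :
  @is_hom K (compl G) f = [forall e, edge e ==> (f e.1 != f e.2) && ~~ sg_adj (f e.1) (f e.2)].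
Proof.
apply/is_homP/forallP => [fP e|fP u v uv].
  by apply/implyP => /andP[_ /fP].
have [lt|lt|/val_inj E] := ltngtP u v; last by rewrite E sg_irr in uv.
  by have /implyP := fP (u, v); apply; rewrite /edge lt.
rewrite sg_sym; have /implyP := fP (v, u); apply.
by rewrite /edge lt sg_sym.
Qed.

Lemma is_hom_compl_expand f :
  (@is_hom K (compl G) f)%:R =
  \sum_t (-1) ^+ #|support t| * [forall e, obeys f e (t e)]%:R :> int.
Proof.
rewrite is_hom_edges -prod_bool_natr.
pose term e l : int := (if l == None then 1 else -1) * (obeys f e l)%:R.
transitivity (\prod_e \sum_l term e l).
  apply: eq_bigr => e _.
  (* On an edge, the three labels give 1 - [equal ends] - [adjacent ends]. This is the required
     indicator, since equality and adjacency exclude each other. *)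
  rewrite (bigD1 None) //= (bigD1 (Some true)) //= (bigD1 (Some false)) //=.
  rewrite big1 ?addr0 => [|[[]|]] //.
  rewrite /term /= mul1r !mulN1r; case: (edge e) => //=.
  by case: eqP => [->|_]; rewrite ?sg_irr //=; case: sg_adj.
rewrite bigA_distr_bigA; apply: eq_bigr => t _.
rewrite big_split /= prod_bool_natr; congr (_ * _).
rewrite (eq_bigr (fun e => if e \in support t then -1 else 1)).
  by rewrite -big_mkcond prodr_const.
by move=> e _; rewrite inE; case: eqP.
Qed.

Lemma obeys_block t f : (forall e, obeys f e (t e)) ->
  forall x y, block t x = block t y -> f x = f y.
Proof.
move=> fP x y /eqP; rewrite eq_block => /connectP[p + ->].
elim: p x => //= z p IH x /andP[/andP[xz /eqP lxz] /IH <-].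
move: lxz; rewrite /label; case: ifP => _ te.
  by have := fP (x, z); rewrite te => /andP[_ /eqP].
by have := fP (z, x); rewrite te => /andP[_ /eqP].
Qed.

(** A map obeying [t] is constant on blocks and so factors through a homomorphism from
    [label_minor t]. If [t] is not admissible, a non-edge is labelled or a kept edge would map to a
    loop. *)
Lemma card_obeys t :
  #|[pred f | [forall e, obeys f e (t e)]]| =
  (if admissible t then hom (label_minor t) G else 0)%N.
Proof.
case: ifPn => [/admissibleP tP|nt]; last first.
  apply: eq_card0 => f; rewrite inE; apply/negP => /forallP fP.
  case/negP: nt; apply/admissibleP => e b te.
  have := fP e; rewrite te => /andP[-> fe]; split=> // b0.
  by move=> /(obeys_block fP) E; move: fe; rewrite b0 E sg_irr.
rewrite homE.
pose phi (g : {ffun 'I_#|{: block_type t}| -> 'I_(sg_n G)}) : {ffun V -> 'I_(sg_n G)} :=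
  [ffun u => g (block t u)].
have phi_inj : injective phi.
  move=> h1 h2 /ffunP E; apply/ffunP => a.
  by have := E (block_rep a); rewrite !ffunE block_repK.
rewrite -(card_image phi_inj); apply: eq_card => f; rewrite inE.
apply/forallP/imageP => [fP|[g /is_homP gP ->] e].
  exists [ffun a => f (block_rep a)]; last first.
    by apply/ffunP => u; rewrite !ffunE; apply: (obeys_block fP); rewrite block_repK.
  apply/is_homP => a b /andP[ab /existsP[u /existsP[v /and3P[uv /eqP ua /eqP vb]]]].
  rewrite !ffunE -ua -vb.
  rewrite !(obeys_block fP (block_repK _)).
  move: uv; rewrite support_adj => /andP[uv].
  case luv: (label t u v) => [[]|] // _.
    by case/eqP: ab; rewrite -ua -vb; apply: contracted_block; rewrite /contracted uv luv.
  move: luv; rewrite /label; case: ifP => _ te.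
    by have := fP (u, v); rewrite te => /andP[].
  by have := fP (v, u); rewrite te => /andP[_]; rewrite sg_sym.
case te: (t e) => [b|//]; have [ee eb] := tP e b te.
have [_ adj_e] := andP ee; rewrite /= ee /= !ffunE.
case: b => [|] in te eb *.
  by rewrite (@contracted_block t e.1 e.2) // /contracted adj_e label_edge // te.
apply: gP; apply/andP; split; first by apply/eqP/eb.
apply/existsP; exists e.1; apply/existsP; exists e.2.
by rewrite !eqxx support_adj adj_e label_edge // te.
Qed.

Lemma hom_compl_expand :
  (hom K (compl G))%:Z = \sum_t weight t * (hom (label_minor t) G)%:Z.
Proof.
rewrite homE card_sum_intr /=.
under eq_bigr do rewrite is_hom_compl_expand.
rewrite exchange_big /=; apply: eq_bigr => t _.
rewrite -mulr_sumr /weight -mulrA -card_sum_intr card_obeys.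
by case: admissible; rewrite ?mul1r ?mul0r.
Qed.
End Target.
End Labelling.

(** * Labellings realising contractions, and isolated vertices *)

(** Surviving edges are contracted inside the fibres of [p] and kept between them; connectedness of
    the fibres makes them exactly the blocks. *)
Lemma exists_labelling (K : sgraph) (r : rel 'I_(sg_n K)) k (p : 'I_(sg_n K) -> 'I_k) :
  (forall a, exists u, p u = a) -> blocks_connected (F := del_edges r) p ->
  exists2 t : {ffun 'I_(sg_n K) * 'I_(sg_n K) -> option bool},
    admissible t & iso (label_minor t) (@quot (del_edges r) k p).
Proof.
move=> p_surj p_conn; pose adj : rel 'I_(sg_n K) := del_adj r.
pose t : {ffun 'I_(sg_n K) * 'I_(sg_n K) -> option bool} :=
  [ffun e => if edge e && adj e.1 e.2 then Some (p e.1 == p e.2) else None].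
have labelE (x y : 'I_(sg_n K)) : label t x y = if adj x y then Some (p x == p y) else None.
  rewrite /label /t; case: ltngtP => xy; rewrite !ffunE /edge /= ?xy /=.
  - by rewrite /adj /del_adj; case: (sg_adj x y).
  - by rewrite /adj del_sym eq_sym /del_adj sg_sym; case: (sg_adj x y).
  - by rewrite (val_inj xy) ltnn /adj del_irr.
have suppE (x y : 'I_(sg_n K)) : @sg_adj (support_graph t) x y = adj x y.
  rewrite support_adj labelE /adj /del_adj.
  by case: (sg_adj x y) => //=; case: ifP.
have contrE (x y : 'I_(sg_n K)) : contracted t x y = adj x y && (p x == p y).
  rewrite /contracted labelE /adj /del_adj; case: (sg_adj x y) => //=.
  by case: (r x y && r y x) => //=; case: (p x == p y).
have blockE (x y : 'I_(sg_n K)) : (block t x == block t y) = (p x == p y).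
  rewrite eq_block (eq_connect contrE); apply/idP/eqP; last exact: p_conn.
  by case/connectP => q + ->; elim: q x => //= z q IH x /andP[/andP[_ /eqP ->] /IH].
exists t.
  apply/admissibleP => e b; rewrite ffunE; case: ifP => // /andP[-> _] [<-].
  by split=> // /eqP pe /eqP; rewrite blockE; apply/negP/eqP.
have [s sK] := fin_all_exists p_surj.
have repK x : p (block_rep (block t x)) = p x by apply/eqP; rewrite -blockE block_repK.
exists (fun a => p (block_rep a)); split.
  exists (fun a => block t (s a)) => a; last by rewrite repK sK.
  by rewrite -[RHS]block_repK; apply/eqP; rewrite blockE sK.
move=> a b /=; rewrite /quot_adj -(blockE (block_rep a)) !block_repK; congr (_ && _).
apply: eq_existsb => u; apply: eq_existsb => v.
by rewrite suppE -!blockE !block_repK.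
Qed.

Lemma iso_quot_inj (K : sgraph) k (p : 'I_(sg_n K) -> 'I_k) :
  (forall a, exists u, p u = a) -> injective p -> iso K (quot p).
Proof.
move=> p_surj pI; have [s sK] := fin_all_exists p_surj.
exists p; split; first by exists s => // u; apply: pI; rewrite sK.
move=> u v /=; rewrite /quot_adj; apply/andP/idP => [[_]|uv].
  by case/existsP=> x /existsP[y /and3P[xy /eqP/pI <- /eqP/pI <-]].
split; first by rewrite (inj_eq pI); apply: contraTneq uv => ->; rewrite sg_irr.
by apply/existsP; exists u; apply/existsP; exists v; rewrite uv !eqxx.
Qed.

Lemma card_extensions (n n' m : nat) (f : 'I_n -> 'I_n') (h : 'I_n -> 'I_m) :
  injective f ->
  #|[pred g : {ffun 'I_n' -> 'I_m} | [forall u, g (f u) == h u]]| = (m ^ (n' - n))%N.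
Proof.
move=> fI; pose Q (x : 'I_n') : pred 'I_m := [pred y | [forall u, (f u == x) ==> (y == h u)]].
rewrite (eq_card (B := family Q)) => [|g]; last first.
  rewrite inE; apply/forallP/familyP => [gP x|gP u].
    by apply/forallP => u; apply/implyP => /eqP <-.
  by have /forallP/(_ u)/implyP := gP (f u); apply.
rewrite card_family foldrE big_map big_enum /=.
rewrite (bigID (mem (codom f))) /= big1 ?mul1n => [|x /codomP[u ->]]; last first.
  rewrite -(card1 (h u)); apply: eq_card => y; rewrite !inE.
  apply/forallP/eqP => [/(_ u)|-> v]; first by rewrite eqxx => /eqP.
  by apply/implyP => /eqP/fI ->.
rewrite (eq_bigr (fun=> m)) => [|x xf]; last first.
  rewrite -[RHS]card_ord; apply: eq_card => y; rewrite !inE; apply/forallP => u.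
  by apply/implyP => /eqP E; move: xf; rewrite -E codom_f.
rewrite prod_nat_const; congr (_ ^ _)%N.
have := cardC (mem (codom f)); rewrite (card_codom fI) !card_ord => E.
by rewrite -[in RHS]E addKn; apply: eq_card.
Qed.

(** [D] is a copy of [F] with isolated vertices added: a homomorphism from [D] is one from [F]
    together with free values off the image of [f]. *)
Lemma hom_add_isolated (F D G : sgraph) (f : 'I_(sg_n F) -> 'I_(sg_n D)) :
  injective f ->
  (forall x y, sg_adj x y = [exists u, exists v, [&& sg_adj u v, f u == x & f v == y]]) ->
  hom D G = (hom F G * sg_n G ^ (sg_n D - sg_n F))%N.
Proof.
move=> fI DE; rewrite !homE -sum1_card.
rewrite (partition_big (fun g : {ffun 'I_(sg_n D) -> 'I_(sg_n G)} => [ffun u => g (f u)])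
   [pred h : {ffun 'I_(sg_n F) -> 'I_(sg_n G)} | is_hom h]) /= => [|g /is_homP gP].
  rewrite -sum_nat_const; apply: eq_bigr => h /is_homP hP.
  rewrite -(card_extensions h fI) -sum1_card; apply: eq_bigl => g; rewrite !inE.
  apply/andP/forallP => [[_ /eqP <-] u|gh]; first by rewrite ffunE.
  split; last by apply/eqP/ffunP => u; rewrite ffunE; apply/eqP.
  apply/is_homP => x y; rewrite DE => /existsP[u /existsP[v /and3P[uv /eqP <- /eqP <-]]].
  by rewrite !(eqP (gh _)) hP.
apply/is_homP => u v uv; rewrite !ffunE; apply: gP; rewrite DE.
by apply/existsP; exists u; apply/existsP; exists v; rewrite uv !eqxx.
Qed.

Lemma hom_edgeless (F G : sgraph) :
  (forall x y : 'I_(sg_n F), ~~ sg_adj x y) -> hom F G = (sg_n G ^ sg_n F)%N.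
Proof.
move=> F0; rewrite homE -[in RHS](card_ord (sg_n G)) -[in RHS](card_ord (sg_n F)) -card_ffun.
by apply: eq_card => f; rewrite !inE; apply/is_homP => u v uv; have := F0 u v; rewrite uv.
Qed.

(** * Closure of [cl C] under deletion, contraction and subgraphs *)

Section ComplPreserved.
Variable C : sgraph -> Prop.
Hypothesis C_compl : compl_preserved C.

(* If all contributions to the coefficient of F0 carry the same sign, they cannot cancel. *)
Lemma cl_label_minor (K F0 : sgraph) (m : nat) :
  cl C K ->
  (exists2 t : {ffun 'I_(sg_n K) * 'I_(sg_n K) -> option bool},
     admissible t & iso (label_minor t) F0) ->
  (forall t : {ffun 'I_(sg_n K) * 'I_(sg_n K) -> option bool},
     admissible t -> iso (label_minor t) F0 -> #|darts (support_graph t)| = m) ->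
  cl C F0.
Proof.
move=> clK [t0 t0P t0F0] tm G H GH.
pose d F : int := (hom F G)%:Z - (hom F H)%:Z.
(* Equivalence passes to the products with [X], then to their complements; subtracting the two
   expansions gives the linear relation. *)
have w0 X : \sum_t (@weight K t * d (label_minor t)) * (hom (label_minor t) X)%:Z = 0.
  have : hom_equiv C (prod_graph G X) (prod_graph H X).
    by move=> F CF; rewrite !hom_prod GH.
  move/C_compl/clK/(congr1 Posz)/eqP; rewrite !hom_compl_expand -subr_eq0 -sumrB.
  move/eqP => E; rewrite -[RHS]E; apply: eq_bigr => t _.
  by rewrite !hom_prod !PoszM -mulrBr -mulrBl mulrA.
have := hom_independent F0 w0.
(* Half of the common dart count [m] is the size of the support, so the sign is constant. *)
rewrite (eq_bigr (fun t => (-1) ^+ m./2 * d F0 * (admissible t)%:R)) => [|t /isoP tF0].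
  move/eqP; rewrite -mulr_sumr !mulf_eq0 expf_eq0 oppr_eq0 oner_eq0 andbF /=.
  case/orP => [|/eqP s0]; first by rewrite subr_eq0 eqz_nat => /eqP.
  suff: 0 < \sum_(t | isob (@label_minor K t) F0) (admissible t)%:R :> int by rewrite s0 ltxx.
  rewrite (bigD1 t0) /=; last exact/isoP.
  by rewrite t0P ltr_pwDl // sumr_ge0.
rewrite /weight; case tP: (admissible t); last by rewrite !mulr0 mul0r.
rewrite !mulr1 -(tm t) // card_darts_support // doubleK.
by rewrite /d !(hom_iso tF0 (iso_refl _)).
Qed.

(** A label minor isomorphic to a deletion of [K] has as many vertices as [K], so its blocks are
    singletons and it is isomorphic to its support graph. This fixes the dart count. *)
Lemma cl_del_edges : closed_deletion (cl C).
Proof.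
move=> K r clK; have id_surj (a : 'I_(sg_n K)) : exists u, id u = a by exists a.
have id_conn : blocks_connected (F := del_edges r) id by move=> u v ->; exact: connect0.
have isoD : iso (del_edges r) (@quot (del_edges r) _ id).
  exact: (@iso_quot_inj (del_edges r)).
have [t tP tD] := exists_labelling id_surj id_conn.
apply: (cl_label_minor (m := #|darts (del_edges r)|) clK).
  by exists t => //; apply: iso_trans tD (iso_sym isoD).
move=> {tP tD}t _ tD; rewrite -(iso_darts tD); apply: iso_darts.
have b_surj (a : 'I_#|{: block_type t}|) : exists u, block t u = a.
  by exists (block_rep a); rewrite block_repK.
apply: (@iso_quot_inj (support_graph t)) => //.
have rI : injective (@block_rep K t) := can_inj (@block_repK K t).
have rB : bijective (@block_rep K t).
  apply: inj_card_bij => //; case: tD => f [/bij_eq_card + _].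
  by rewrite /= !card_ord => ->.
exact: bij_inj (bij_can_bij rB (@block_repK K t)).
Qed.

(* Descend to an edge-minimal deletion of K that still contracts to F: there every
   labelling producing F uses all the edges. *)
Lemma cl_contraction : closed_contraction (cl C).
Proof.
move=> K F; have [m] := ubnP #|darts K|; elim: m => // m IH in K *; rewrite ltnS => Km clK KF.
have [/existsP[t /and3P[tP /isoP tF tK]]|/existsPn tK] :=
  boolP [exists t : {ffun 'I_(sg_n K) * 'I_(sg_n K) -> option bool},
          [&& admissible t, isob (label_minor t) F & (#|darts (support_graph t)| < #|darts K|)%N]].
  apply: (IH (support_graph t)); [exact: leq_trans tK Km | exact: cl_del_edges |].
  have [k [p [p_surj [p_conn isop]]]] := label_minor_contraction t.
  by exists k, p; split=> //; split=> //; apply: iso_trans (iso_sym tF) isop.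
case: KF => k [p [p_surj [p_conn isoF]]].
(* Nothing is deleted; [D] only puts [K] in the form that [exists_labelling] expects. *)
pose D := @del_edges K (fun _ _ => true).
have adjD (x y : 'I_(sg_n K)) : @sg_adj D x y = @sg_adj K x y by rewrite /= /del_adj !andbT.
have D_conn : blocks_connected (F := D) p.
  move=> u v /p_conn; rewrite (@eq_connect _ _ (fun x y => sg_adj x y && (p x == p y))) //.
  by move=> x y; rewrite adjD.
have [t tP tF] := exists_labelling p_surj D_conn.
apply: (cl_label_minor (m := #|darts K|) clK).
  exists t => //; apply: iso_trans tF _; apply: iso_trans (iso_sym isoF).
  exists id; split; first by exists id.
  move=> a b /=; rewrite /quot_adj; congr (_ && _).
  by apply: eq_existsb => u; apply: eq_existsb => v; rewrite adjD.
move=> {tP tF}t tP /isoP tF; have := tK t; rewrite tP tF /= -leqNgt => le.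
apply/eqP; rewrite eqn_leq le andbT subset_leq_card //.
by apply/subsetP => e; rewrite !inE support_adj => /andP[].
Qed.

(** Deleting the edges of [F] outside the image of [H] leaves [H] plus isolated vertices. These
    contribute a power of the order of the target, which is cancelled. *)
Lemma cl_subgraph (F H : sgraph) : cl C F -> subgraph H F -> cl C H.
Proof.
move=> clF [f [fI fP]] G G' GG'.
(* The edgeless deletion of [F] lies in [cl C]; it gives equal orders of [G] and [G'] unless [F] is
   empty, in which case [H] is empty too. *)
have nG : (sg_n G ^ sg_n F = sg_n G' ^ sg_n F)%N.
  have /(_ G G' GG') := cl_del_edges (fun _ _ => false) clF.
  by rewrite !hom_edgeless // => x y; rewrite /= /del_adj !andbF.
have [F0|F0] := posnP (sg_n F).
  have H0 : sg_n H = 0%N.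
    by apply/eqP; rewrite -leqn0 -F0 -(card_ord (sg_n F)) -{1}(card_ord (sg_n H)) (leq_card f).
  have noH (x y : 'I_(sg_n H)) : ~~ sg_adj x y by have := ltn_ord x; rewrite {2}H0.
  by rewrite !hom_edgeless // H0.
have {}nG : sg_n G = sg_n G' by apply/eqP; rewrite -(eqn_exp2r _ _ F0) nG.
(* Cancelling the power needs a positive base; if [G] is empty, so is [G'], and they are
   isomorphic. *)
have [G0|G0] := posnP (sg_n G).
  by apply: hom_iso; [exact: iso_refl | apply: iso_of_n0; rewrite -?nG].
pose r x y := [exists u, exists v, [&& sg_adj u v, f u == x & f v == y]].
have := cl_del_edges r clF GG'.
have rE x y : @sg_adj (del_edges r) x y = r x y.
  apply/and3P/existsP => [[_ /existsP]//|[u /existsP[v /and3P[uv /eqP <- /eqP <-]]]].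
  split; first exact: fP.
    by apply/existsP; exists u; apply/existsP; exists v; rewrite uv !eqxx.
  by apply/existsP; exists v; apply/existsP; exists u; rewrite sg_sym uv !eqxx.
rewrite !(@hom_add_isolated H (del_edges r) _ f fI rE) -nG => /eqP.
by rewrite eqn_pmul2r ?expn_gt0 ?G0 // => /eqP.
Qed.
End ComplPreserved.

(** * The three implications *)

(** The weights do not depend on the target and each [label_minor t] is a contraction of a deletion,
    hence in [C]: the expansions agree term by term. *)
Lemma compl_preserved_of_closed (C : sgraph -> Prop) :
  closed_contraction C -> closed_deletion C -> compl_preserved C.
Proof.
move=> Cc Cd.
have half G H : hom_equiv C G H -> hom_equiv C (compl G) (compl H).
  move=> GH K CK; apply/eqP; rewrite -eqz_nat !hom_compl_expand; apply/eqP.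
  apply: eq_bigr => t _; congr (_ * Posz _); apply: GH.
  by apply: Cc (label_minor_contraction t); exact: Cd.
move=> G H; split; first exact: half.
move/half => GH K CK; have := GH K CK.
by rewrite !(hom_iso (iso_refl K) (iso_compl_compl _)).
Qed.

Lemma hom_equiv_cl (C : sgraph -> Prop) (G H : sgraph) :
  hom_equiv (cl C) G H <-> hom_equiv C G H.
Proof.
split=> [GH K CK|GH K]; last by apply.
by apply: GH => G' H'; apply.
Qed.

Lemma subgraph_refl (F : sgraph) : subgraph F F.
Proof. by exists id; split. Qed.

Lemma contraction_refl (F : sgraph) : contraction_of F F.
Proof.
have id_surj (a : 'I_(sg_n F)) : exists u, id u = a by exists a.
exists (sg_n F), id; split=> //; split; last exact: iso_quot_inj.
by move=> u v ->; exact: connect0.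
Qed.

Theorem theorem8 (C : sgraph -> Prop) :
  ((closed_contraction C /\ closed_deletion C) -> compl_preserved C) /\
  (compl_preserved C <-> minor_closed (cl C)).
Proof.
split; first by case=> Cc Cd; exact: compl_preserved_of_closed.
split=> [C_compl K K' clK [F [KF FK']]|C_minor].
  apply: (cl_subgraph C_compl) FK'; exact: cl_contraction KF.
(* The first implication is applied to [cl C], which defines the same equivalence as [C]. *)
have cl_compl : compl_preserved (cl C).
  apply: compl_preserved_of_closed => [F F' clF FF'|F r clF]; apply: C_minor clF _.
    by exists F'; split=> //; exact: subgraph_refl.
  exists F; split; first exact: contraction_refl.
  by exists id; split=> // u v /and3P[].
move=> G H; have E := hom_equiv_cl C.
split=> GH; apply: (iffLR (E _ _)).
  by apply: (iffLR (cl_compl G H)); apply: (iffRL (E _ _)).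
by apply: (iffRL (cl_compl G H)); apply: (iffRL (E _ _)).
Qed.
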